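(* Let $q,r$ be positive integers and let $\sigma=\{\mathbf a_1,\dots,\mathbf a_d\}\subseteq\mathcal{N}^r_q$ be a face of $\mathbb{T}^r_q$. The following are equivalent. (1) $\sigma\in\mathbb{S}^r_q$; (2) for every nonempty $C\subseteq[d]$ the only solutions $\mathbf w\in\mathcal{N}^r_q$ to the system of inequalities $$\mathbf w\cdot\mathbf e_A\le\max_{i\in C}\{\mathbf a_i\cdot\mathbf e_A\}\quad\text{for all }A\subseteq[q]$$ are $\{\mathbf a_i : i\in C\}$; (3) for every nonempty $C\subseteq[d]$ the only solutions $\mathbf w\in\mathcal{N}^r_q$ to the system of inequalities $$\min_{i\in C}\{\mathbf a_i\cdot\mathbf e_A\}\le\mathbf w\cdot\mathbf e_A\le\max_{i\in C}\{\mathbf a_i\cdot\mathbf e_A\}\quad\text{for all }A\subseteq[q]$$ are $\{\mathbf a_i : i\in C\}$; (4) $\sigma0^p=\{\mathbf a_10^p,\dots,\mathbf a_d0^p\}\in\mathbb{S}^r_{q+p}$ for every $p\in\mathbb{N}$; (5) $0^p\sigma=\{0^p\mathbf a_1,\dots,0^p\mathbf a_d\}\in\mathbb{S}^r_{q+p}$ for every $p\in\mathbb{N}$; (6) $\pi\sigma=\{\pi\mathbf a_1,\dots,\pi\mathbf a_d\}\in\mathbb{S}^r_q$ for every permutation $\pi\in S_q$; (7) $\sigma+\mathbf v=\{\mathbf a_1+\mathbf v,\dots,\mathbf a_d+\mathbf v\}\in\mathbb{S}_q^{r+|\mathbf v|}$ for every $\mathbf v\in\mathbb{Z}^q$ such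 that $\mathbf a_i+\mathbf v\ge\mathbf 0$ for each $i\in[d]$.
   Context: Let $\mathsf{k}$ be a field, $[q]=\{1,\dots,q\}$, $|\mathbf a|=a_1+\cdots+a_q$, and $\mathcal{N}^r_q=\{\mathbf a\in\mathbb{N}^q : |\mathbf a|=r\}$. For $A\subseteq[q]$, $\mathbf e_A=\sum_{i\in A}\mathbf e_i$ is the characteristic vector of $A$ in $\mathbb{R}^q$. The $q$-extremal ideal $\mathcal{E}_q$ is the ideal of $\mathsf{k}[x_A : \emptyset\ne A\subseteq[q]]$ generated by $\epsilon_i=\prod_{A\ni i}x_A$, $i\in[q]$. Its power $\mathcal{E}_q^{\,r}$ is minimally generated by the monomials $\epsilon^{\mathbf a}=\epsilon_1^{a_1}\cdots\epsilon_q^{a_q}$, $\mathbf a\in\mathcal{N}^r_q$. The Taylor complex $\mathbb{T}^r_q$ is the full simplex on $\mathcal{N}^r_q$, each face $\sigma$ being labeled by $\mathbf{m}_\sigma=\mathrm{lcm}(\epsilon^{\mathbf a}:\mathbf a\in\sigma)$. The Scarf complex $\mathbb{S}^r_q$ is the subcomplex of all $\sigma$ with $\mathbf{m}_\sigma\ne\mathbf{m}_\tau$ for every $\tau\subseteq\mathcal{N}^r_q$, $\tau\neq\sigma$. (For exponent $0$, $\mathcal{N}^0_q=\{\mathbf 0\}$ and the same definition is used.) For $\mathbf a\in\mathbb{Z}^q$: $\mathbf a0^p$ and $0^p\mathbf a$ in $\mathbb{Z}^{p+q}$ are obtained by appending $p$ zeros to the right and to the left of $\mathbf a$, respectively; $\pi\mathbf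 a=(a_{\pi(1)},\dots,a_{\pi(q)})$ for $\pi\in S_q$; and $\mathbf a\le\mathbf b$ means $a_i\le b_i$ for all $i$. *)

(* Defs.v *)
From HB Require Import structures.
From mathcomp Require Export all_boot all_order all_algebra.
From mathcomp Require Export fingroup perm.
From mathcomp Require Export finmap mpoly.

Set Implicit Arguments.
Unset Strict Implicit.
Unset Printing Implicit Defensive.

Import GRing.Theory.

Local Open Scope ring_scope.
Local Open Scope fset_scope.

(* [q] is 'I_q; vectors of N^q and Z^q are row vectors. *)

Definition norm1 (R : nmodType) (q : nat) (a : 'rV[R]_q) : R := \sum_i a 0 i.

Definition charv (q : nat) (A : {set 'I_q}) : 'rV[nat]_q :=
  \row_i nat_of_bool (i \in A).

Definition dotv (q : nat) (u v : 'rV[nat]_q) : nat :=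
  (\sum_i u ord0 i * v ord0 i)%N.

Definition inN (q r : nat) : pred 'rV[nat]_q := fun a => norm1 a == r.

(* The index set of the variables x_A; {mpoly k[n]} wants variables numbered
   by 'I_n, so x_A is the variable whose number is the rank of A. *)
Definition nesubset (q : nat) : finType := {A : {set 'I_q} | A != set0}.

Definition nvars (q : nat) : nat := #|nesubset q|.

Section ExtremalIdeal.

Variables (k : fieldType) (q : nat).

Definition xvar (A : nesubset q) : {mpoly k[nvars q]} := 'X_(enum_rank A).

Definition eps (i : 'I_q) : {mpoly k[nvars q]} :=
  \prod_(A : nesubset q | i \in val A) xvar A.

Definition epsX (a : 'rV[nat]_q) : {mpoly k[nvars q]} :=
  \prod_i eps i ^+ a 0 i.

(* The monomial lcm (epsX a : a \in s). Each epsX a is a single monomial with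
   coefficient 1, and [mlead] reads off its exponent vector. *)
Definition label (s : {fset 'rV[nat]_q}) : {mpoly k[nvars q]} :=
  'X_[\big[@mlcm _ / 0%MM]_(a <- s) mlead (epsX a)].

(* Faces are nonempty: this matters for r = 0, where the vertex 0 and the
   empty set would otherwise share the label 1 and {0} would not be Scarf. *)
Definition taylor (r : nat) (s : {fset 'rV[nat]_q}) : Prop :=
  s != fset0 /\ {in s, forall a, inN r a}.

Definition scarf (r : nat) (s : {fset 'rV[nat]_q}) : Prop :=
  taylor r s /\ forall t, taylor r t -> t <> s -> label s <> label t.

End ExtremalIdeal.

Definition append0 (p q : nat) (a : 'rV[nat]_q) : 'rV[nat]_(q + p) :=
  row_mx a (const_mx 0%N).

Definition prepend0 (p q : nat) (a : 'rV[nat]_q) : 'rV[nat]_(p + q) :=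
  row_mx (const_mx 0%N) a.

Definition permv (q : nat) (s : {perm 'I_q}) (a : 'rV[nat]_q) : 'rV[nat]_q :=
  \row_i a 0 (s i).

Definition toZ (q : nat) (a : 'rV[nat]_q) : 'rV[int]_q := map_mx Posz a.

Definition nonnegv (q : nat) (u : 'rV[int]_q) : Prop := forall i, 0 <= u 0 i.

(* Only meant for [nonnegv] vectors, where it inverts [toZ]. *)
Definition toN (q : nat) (u : 'rV[int]_q) : 'rV[nat]_q := map_mx absz u.

Definition maxC (d : nat) (C : {set 'I_d}) (f : 'I_d -> nat) : nat :=
  (\max_(i in C) f i)%N.

(* [minn] has no neutral element on nat; the seed [maxC C f] bounds all the
   values, so this is the minimum when C is nonempty. *)
Definition minC (d : nat) (C : {set 'I_d}) (f : 'I_d -> nat) : nat :=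
  \big[minn / maxC C f]_(i in C) f i.

(* Main.v *)
Require Import Defs.
From mathcomp Require Import zify.

Set Implicit Arguments.
Unset Strict Implicit.
Unset Printing Implicit Defensive.

Import GRing.Theory Num.Theory.

Local Open Scope fset_scope.
Local Open Scope ring_scope.

(** The exponent of x_A in epsilon^w is the weight w . e_A, so the label of a face
    s records, for every A, the maximal weight of A over s.  Call w dominated by
    s when for every A some x in s satisfies w . e_A <= x . e_A.  Adding a
    dominated vector to s, or removing from s a vector dominated by the others,
    does not change the label; conversely two faces with equal labels dominate
    each other's vertices.  Hence s is Scarf iff no w in N^r_q is dominated by
    s minus w ([scarfP]).  Everything follows from this criterion.

    - (1) <-> (2): the vectors dominated by {a_i : i in C} are the solutions of
      (2), and the critical C for a given w is {i : a_i <> w}.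
    - (2) <-> (3): all vectors have total weight r, so an upper bound on the
      weight of the complement of A is a lower bound on the weight of A; the
      lower bounds of (3) are therefore implied by the upper ones.
    - (4), (5), (6): the three operations push a vector forward along an
      injection h of index sets.  A vector dominated by a pushed-forward face has
      weight 0 outside the image of h, hence is itself pushed forward, and
      weights are preserved ([scarf_pushv]).  So each of (4) for a single p, (5)
      for a single p and (6) for a single permutation is equivalent to (1).
    - (7): a vector w' dominated by s + v also satisfies the lower bounds
      of (3), which for singletons A give w' >= v.  So w' = w + v with w
      nonnegative, and all weights of A are translated by the same amount
      ([scarf_shiftv]); taking v = 0 returns (1). *)

(** * Weights on subsets of coordinates *)

Local Notation wt w A := (dotv w (charv A)).

Lemma wtE q (w : 'rV[nat]_q) (A : {set 'I_q}) :
  wt w A = (\sum_(i in A) w 0%R i)%N.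
Proof.
rewrite /dotv [RHS]big_mkcond; apply: eq_bigr => i _.
by rewrite mxE; case: (i \in A); rewrite ?muln1 ?muln0.
Qed.

Lemma wt0 q (w : 'rV[nat]_q) : wt w set0 = 0%N.
Proof. by rewrite wtE big_set0. Qed.

Lemma wt1 q (w : 'rV[nat]_q) i : wt w [set i] = w 0 i.
Proof. by rewrite wtE big_set1. Qed.

Lemma wtC q r (w : 'rV[nat]_q) (A : {set 'I_q}) :
  inN r w -> (wt w A + wt w (~: A) = r)%N.
Proof.
rewrite /inN /norm1 => /eqP <-; rewrite !wtE.
rewrite (bigID (mem A) predT) /=; congr (_ + _)%N.
by apply: eq_bigl => i; rewrite inE.
Qed.

(** Since all weights add up to r, complementing A reverses comparisons; this
    is what turns upper bounds on all weights into lower bounds. *)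
Lemma leq_wtC q r (w x : 'rV[nat]_q) (A : {set 'I_q}) :
  inN r w -> inN r x -> (wt w (~: A) <= wt x (~: A))%N = (wt x A <= wt w A)%N.
Proof. by move=> /(wtC A) + /(wtC A); lia. Qed.

(** * Labels and domination *)

(** Pointwise form of w . e_A <= max over s, which avoids the maximum of an
    empty family: taking A = set0 forces s to be nonempty. *)
Definition dominated q (s : {fset 'rV[nat]_q}) (w : 'rV[nat]_q) : Prop :=
  forall A : {set 'I_q}, exists2 x, x \in s & (wt w A <= wt x A)%N.

Lemma dominated_self q (s : {fset 'rV[nat]_q}) w : w \in s -> dominated s w.
Proof. by move=> ws A; exists w. Qed.

Lemma dominatedS q (s t : {fset 'rV[nat]_q}) w :
  s `<=` t -> dominated s w -> dominated t w.
Proof. by move=> /fsubsetP st d A; have [x /st xt le] := d A; exists x. Qed.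

Lemma dominated_lower q r (s : {fset 'rV[nat]_q}) w (A : {set 'I_q}) :
  {in s, forall x, inN r x} -> inN r w -> dominated s w ->
  exists2 x, x \in s & (wt x A <= wt w A)%N.
Proof.
move=> sN wN d; have [x xs le] := d (~: A); exists x => //.
by rewrite -(leq_wtC A wN (sN _ xs)).
Qed.

Lemma leq_max_wt q (s : {fset 'rV[nat]_q}) (A : {set 'I_q}) w :
  w \in s -> (wt w A <= \max_(x <- s) wt x A)%N.
Proof.
move=> ws.
exact: (@leq_bigmax_seq _ (enum_fset s) predT (fun x => wt x A) w ws isT).
Qed.

Section Labels.

Variables (k : fieldType) (q : nat).

(** x_A divides epsilon_i exactly once when i belongs to A, so the exponent of
    x_A in epsilon^x collects the entries of x on A. *)
Lemma mlead_epsX (x : 'rV[nat]_q) (A : nesubset q) :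
  mlead (epsX k x) (enum_rank A) = wt x (val A).
Proof.
have -> : epsX k x =
  'X_[(\sum_i (\sum_(B : nesubset q | i \in val B) U_(enum_rank B)) *+ x 0%R i)%MM].
  rewrite (big_morph _ (@mpolyXD _ k) (mpolyX0 _ k)); apply: eq_bigr => i _.
  by rewrite -mpolyXn (big_morph _ (@mpolyXD _ k) (mpolyX0 _ k)).
rewrite mleadXm mnm_sumE wtE [RHS]big_mkcond; apply: eq_bigr => i _.
rewrite mulmnE mnm_sumE; case: ifPn => iA.
  rewrite (bigD1 A) //= mnm1E eqxx big1 ?addn0 ?mul1n // => B /andP[_ nBA].
  by rewrite mnm1E (inj_eq enum_rank_inj) (negPf nBA).
rewrite big1 ?mul0n // => B iB; rewrite mnm1E (inj_eq enum_rank_inj).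
by case: eqP => // eBA; rewrite -eBA iB in iA.
Qed.

Lemma mnm_bigmlcm n (s : seq 'rV[nat]_q) (F : 'rV[nat]_q -> 'X_{1.. n}) j :
  (\big[@mlcm _ / 0%MM]_(x <- s) F x) j = (\max_(x <- s) F x j)%N.
Proof.
apply: (big_morph (fun m : 'X_{1.. n} => m j)) => [m1 m2|]; last by rewrite mnm0E.
by rewrite mlcmE mnmDE mnmBE maxnE.
Qed.

Lemma label_eqP (s t : {fset 'rV[nat]_q}) :
  label k s = label k t <->
  forall A : {set 'I_q}, (\max_(x <- s) wt x A = \max_(x <- t) wt x A)%N.
Proof.
rewrite /label; split=> [eqst A | eqst].
  have := congr1 (@mlead _ _) eqst; rewrite !mleadXm => elcm.
  (* There is no variable for the empty set, but all its weights vanish. *)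
  case: (eqVneq A set0) => [-> | A0].
    by do 2 rewrite (eq_bigr (fun=> 0%N) (fun x _ => wt0 x)); rewrite !big1.
  have /(congr1 (fun m : 'X_{1.. _} => m (enum_rank (Sub A A0 : nesubset q)))) := elcm.
  rewrite !mnm_bigmlcm; under eq_bigr do rewrite mlead_epsX.
  by under [in RHS]eq_bigr do rewrite mlead_epsX.
congr mpolyX; apply/mnmP => j; rewrite !mnm_bigmlcm -[j]enum_valK.
under eq_bigr do rewrite mlead_epsX.
by under [in RHS]eq_bigr do rewrite mlead_epsX.
Qed.

Lemma label_eq_dominated (s t : {fset 'rV[nat]_q}) w :
  t != fset0 -> label k s = label k t -> w \in s -> dominated t w.
Proof.
move=> /fset0Pn[t0 t0t] /label_eqP eqst ws A.
have: (wt w A <= \max_(x <- t) wt x A)%N by rewrite -eqst; exact: leq_max_wt.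
have [/hasP[x xt le] _ | /hasPn no] := boolP (has (fun x => wt w A <= wt x A)%N t).
  by exists x.
have lt x : x \in t -> (wt x A < wt w A)%N by move=> /no; rewrite -ltnNge.
have pos : (0 < wt w A)%N by apply: leq_ltn_trans (lt _ t0t).
rewrite leqNgt => /negP[]; rewrite -(prednK pos) ltnS.
by apply/bigmax_leqP_seq => x /lt + _; rewrite -{1}(prednK pos) ltnS.
Qed.

Lemma dominated_label_eq (s t : {fset 'rV[nat]_q}) :
  (forall w, w \in s -> dominated t w) ->
  (forall w, w \in t -> dominated s w) -> label k s = label k t.
Proof.
move=> st ts; apply/label_eqP => A.
suff le (u v : {fset 'rV[nat]_q}) : (forall w, w \in u -> dominated v w) ->
    (\max_(x <- u) wt x A <= \max_(x <- v) wt x A)%N.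
  by apply/eqP; rewrite eqn_leq !le.
move=> uv; apply/bigmax_leqP_seq => x xu _; have [y yv le] := uv _ xu A.
by apply: leq_trans le _; exact: leq_max_wt.
Qed.

(** The two faces competing for the same label are w |` s and s `\ w: exactly
    one of them differs from s, whether or not w belongs to s.  Conversely, any
    vertex on which s and a face with the same label differ is dominated by the
    other vertices of s. *)
Lemma scarfP r (s : {fset 'rV[nat]_q}) :
  scarf k r s <->
  taylor r s /\ forall w, inN r w -> ~ dominated (s `\ w) w.
Proof.
split=> [[ts sc] | [ts sc]]; split=> //.
  move=> w wN dom.
  have [y ysw _] := dom set0.
  have eqlab : label k (w |` s) = label k (s `\ w).
    apply: dominated_label_eq => x.
      rewrite in_fset1U; case: (eqVneq x w) => [-> //| nxw /= xs].
      by apply: dominated_self; rewrite !inE nxw.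
    by rewrite !inE => /andP[_ xs]; apply: dominated_self; rewrite !inE xs orbT.
  have [ws | nws] := boolP (w \in s).
    apply: (sc (s `\ w)); last by rewrite -eqlab mem_fset1U.
      split; first by apply/fset0Pn; exists y.
      by move=> x /fsetD1P[_ /(proj2 ts)].
    by move=> e; move: ws; rewrite -e !inE eqxx.
  apply: (sc (w |` s)); last by rewrite eqlab mem_fsetD1.
    split; first by apply/fset0Pn; exists w; rewrite !inE eqxx.
    by move=> x; rewrite !inE => /orP[/eqP -> //| /(proj2 ts)].
  by move=> e; move: nws; rewrite -e !inE eqxx.
move=> t tt nts eqlab.
have tsub : t `<=` s.
  apply/fsubsetP => w wit; apply/negPn/negP => nws.
  apply: (sc w); first exact: (proj2 tt).
  by rewrite mem_fsetD1 //; apply: label_eq_dominated (esym eqlab) wit; case: ts.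
apply: nts; apply/eqP; rewrite eqEfsubset tsub; apply/fsubsetP => w ws.
apply/negPn/negP => nwt; apply: (sc w); first exact: (proj2 ts).
apply: (@dominatedS _ t); last by apply: label_eq_dominated eqlab ws; case: tt.
by apply/fsubsetP => x xt; rewrite !inE (fsubsetP tsub) // andbT; apply: contraNneq nwt => <-.
Qed.

End Labels.

(** * Transport of Scarf faces *)

(** A violation w' of the criterion for the image of s is lifted to a
    violation w for s.  The set B is the one whose weights in the target
    compare in the same way as the weights of A in the source. *)
Lemma scarf_image (k : fieldType) q q' r r' (s : {fset 'rV[nat]_q})
    (f : 'rV[nat]_q -> 'rV[nat]_q') :
  {in s, forall x, inN r' (f x)} ->
  (forall w', inN r' w' -> dominated [fset f x | x in s] w' ->
     exists w, [/\ inN r w, f w = w' & forall A : {set 'I_q},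
       exists B : {set 'I_q'}, {in s, forall x,
         (wt w' B <= wt (f x) B)%N -> (wt w A <= wt x A)%N}]) ->
  scarf k r s -> scarf k r' [fset f x | x in s].
Proof.
move=> fN lift /scarfP[[/fset0Pn[x0 x0s] sN] sc]; apply/scarfP; split.
  split; first by apply/fset0Pn; exists (f x0); apply: in_imfset.
  by move=> _ /imfsetP[x xs ->]; apply: fN.
move=> w' w'N dom.
have [w [wN fw cmp]] := lift _ w'N (dominatedS (fsubD1set _ _) dom).
apply: (sc w) => // A; have [B leB] := cmp A.
have [y /fsetD1P[nyw /imfsetP[x xs eyx]] le] := dom B.
rewrite {y}eyx -fw in nyw le; exists x; last by apply: leB; rewrite -?fw.
by rewrite !inE xs andbT; apply: contraNneq nyw => ->.
Qed.

(** Common form of the padding by zeros on either side and of the permutation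
    of coordinates, with h respectively a left shift, a right shift and an
    inverse permutation of indices. *)
Definition pushv q q' (h : 'I_q -> 'I_q') (x : 'rV[nat]_q) : 'rV[nat]_q' :=
  \row_j (\sum_(i | h i == j) x 0%R i)%N.

Lemma wt_pushv q q' (h : 'I_q -> 'I_q') x (B : {set 'I_q'}) :
  wt (pushv h x) B = wt x (h @^-1: B).
Proof.
rewrite !wtE (partition_big h (mem B)) => [|i]; last by rewrite inE.
apply: eq_bigr => j jB; rewrite mxE; apply: eq_bigl => i.
by rewrite inE; case: eqP => [->|]; rewrite ?andbF ?jB.
Qed.

Lemma inN_wt q r (w : 'rV[nat]_q) : inN r w = (wt w setT == r).
Proof. by rewrite wtE /inN /norm1; congr (_ == _); apply: eq_bigl => i; rewrite inE. Qed.

Lemma inN_pushv q q' r (h : 'I_q -> 'I_q') x : inN r (pushv h x) = inN r x.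
Proof. by rewrite !inN_wt wt_pushv preimsetT. Qed.

Section PushInjective.

Variables (q q' : nat) (h : 'I_q -> 'I_q').
Hypothesis h_inj : injective h.

Lemma pushv_im x i : pushv h x 0 (h i) = x 0 i.
Proof. by rewrite mxE (big_pred1 i) // => j; rewrite (inj_eq h_inj). Qed.

Lemma pushv_inj : injective (pushv h).
Proof.
by move=> x y exy; apply/rowP => i; rewrite -pushv_im exy pushv_im.
Qed.

Lemma pushv_pull (w : 'rV[nat]_q') :
  (forall j, j \notin codom h -> w 0 j = 0%N) -> pushv h (\row_i w 0 (h i)) = w.
Proof.
move=> w0; apply/rowP => j; have [/codomP[i ->] | nj] := boolP (j \in codom h).
  by rewrite pushv_im mxE.
rewrite w0 // mxE big_pred0 // => i.
by apply: contraNF nj => /eqP <-; apply: codom_f.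
Qed.

(** Outside the image of h a face pushed forward has weight 0, and so does
    everything it dominates: no new dominated vectors appear. *)
Lemma scarf_pushv (k : fieldType) r (s : {fset 'rV[nat]_q}) :
  scarf k r [fset pushv h x | x in s] <-> scarf k r s.
Proof.
split=> [/scarfP[[/fset0Pn[_ /imfsetP[x0 x0s _]] sN] sc] | ssc].
  apply/scarfP; split.
    split; first by apply/fset0Pn; exists x0.
    by move=> x xs; rewrite -(inN_pushv r h) sN // in_imfset.
  move=> w wN dom; apply: (sc (pushv h w)); first by rewrite inN_pushv.
  move=> B; have [x /fsetD1P[nxw xs] le] := dom (h @^-1: B).
  exists (pushv h x); last by rewrite !wt_pushv.
  by rewrite !inE (inj_eq pushv_inj) nxw in_imfset.
apply: scarf_image (ssc) => [x xs | w' w'N dom].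
  by rewrite inN_pushv; apply: (proj2 (proj1 ssc)).
have pw : pushv h (\row_i w' 0 (h i)) = w'.
  apply: pushv_pull => j nj; have [_ /imfsetP[x _ ->]] := dom [set j].
  rewrite wt_pushv wt1 (_ : h @^-1: [set j] = set0) ?wt0 ?leqn0 => [/eqP //|].
  apply/setP => i; rewrite !inE; apply: contraNF nj => /eqP <-.
  exact: codom_f.
exists (\row_i w' 0 (h i)); split=> // [|A]; first by rewrite -(inN_pushv r h) pw.
exists (h @: A) => x xs; rewrite -[in X in X -> _]pw !wt_pushv.
suff -> : h @^-1: (h @: A) = A by [].
by apply/setP => i; rewrite inE mem_imset.
Qed.

End PushInjective.

Lemma append0E p q (x : 'rV[nat]_q) : append0 p x = pushv (@lshift q p) x.
Proof.
apply/rowP => j; case: (split_ordP j) => i ->.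
  by rewrite pushv_im ?row_mxEl //; apply: lshift_inj.
rewrite row_mxEr !mxE big_pred0 // => l; apply/negbTE.
by rewrite eq_lrshift.
Qed.

Lemma prepend0E p q (x : 'rV[nat]_q) : prepend0 p x = pushv (@rshift p q) x.
Proof.
apply/rowP => j; case: (split_ordP j) => i ->.
  rewrite row_mxEl !mxE big_pred0 // => l; apply/negbTE.
  by rewrite eq_rlshift.
by rewrite pushv_im ?row_mxEr //; apply: rshift_inj.
Qed.

Lemma permvE q (pi : {perm 'I_q}) (x : 'rV[nat]_q) :
  permv pi x = pushv (pi^-1)%g x.
Proof.
apply/rowP => j; rewrite mxE -{2}(permK pi j) pushv_im //.
exact: perm_inj.
Qed.

Definition shiftv q (v : 'rV[int]_q) (x : 'rV[nat]_q) : 'rV[nat]_q :=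
  toN (toZ x + v).

Lemma shiftvE q (v : 'rV[int]_q) x i : nonnegv (toZ x + v) ->
  (shiftv v x 0 i)%:Z = (x 0 i)%:Z + v 0 i.
Proof. by move=> xv; rewrite mxE gez0_abs // !mxE. Qed.

Lemma wt_shiftv q (v : 'rV[int]_q) x (A : {set 'I_q}) : nonnegv (toZ x + v) ->
  (wt (shiftv v x) A)%:Z = (wt x A)%:Z + \sum_(i in A) v 0 i.
Proof.
move=> xv; rewrite !wtE !(big_morph Posz PoszD (erefl _)) -big_split /=.
by apply: eq_bigr => i _; rewrite shiftvE.
Qed.

(** Translation by v can be undone on dominated vectors: they satisfy the
    lower bounds coming from complements, so each coordinate of such a vector is
    at least that of some x + v with x nonnegative. *)
Lemma scarf_shiftv (k : fieldType) q r (v : 'rV[int]_q) (s : {fset 'rV[nat]_q}) :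
  {in s, forall x, nonnegv (toZ x + v)} -> scarf k r s ->
  scarf k `|(r%:Z + norm1 v)%R|%N [fset shiftv v x | x in s].
Proof.
move=> sv ssc; have [[_ sN] _] := ssc.
have norm1E : norm1 v = \sum_(i in [set: 'I_q]) v 0 i.
  by apply: eq_bigl => i; rewrite inE.
have imN x : x \in s -> inN `|(r%:Z + norm1 v)%R|%N (shiftv v x).
  move=> xs; have := sN x xs; rewrite !inN_wt => /eqP <-.
  by rewrite norm1E -(wt_shiftv _ (sv x xs)).
have imN' : {in [fset shiftv v x | x in s],
    forall y, inN `|(r%:Z + norm1 v)%R|%N y}.
  by move=> _ /imfsetP[x xs ->]; apply: imN.
apply: scarf_image (ssc) => // w' w'N dom.
have w'v i : v 0 i <= (w' 0 i)%:Z.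
  have [_ /imfsetP[x xs ->]] := dominated_lower [set i] imN' w'N dom.
  have := sv x xs i.
  rewrite -(lez_nat (wt _ _)) (wt_shiftv _ (sv x xs)) !wt1 big_set1 !mxE; lia.
pose w := shiftv (- v) w'.
have wE i : (w 0 i)%:Z = (w' 0 i)%:Z - v 0 i.
  rewrite shiftvE => [|j]; first by rewrite !mxE.
  by rewrite !mxE; have := w'v j; rewrite -subr_ge0.
have wpos : nonnegv (toZ w + v).
  by move=> i; rewrite [_ 0 i]mxE [toZ _ _ _]mxE wE subrK.
have wv : shiftv v w = w'.
  by apply/rowP => i; apply: (can_inj absz_nat); rewrite shiftvE // wE subrK.
have wt_w A : (wt w' A)%:Z = (wt w A)%:Z + \sum_(i in A) v 0 i.
  by rewrite -wv wt_shiftv.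
exists w; split=> // [|A].
  have [x0 /imfsetP[x xs _] _] := dom set0.
  have := imN x xs; have := sN x xs; move: w'N; rewrite !inN_wt.
  have := wt_shiftv setT (sv x xs); have := wt_w setT; lia.
exists A => x xs; have := wt_w A; have := wt_shiftv A (sv x xs); lia.
Qed.

(** * Extremal weights over an indexed family *)

Section Family.

Variables (q r d : nat) (a : 'I_d -> 'rV[nat]_q).
Implicit Type C : {set 'I_d}.

Lemma dominated_maxC C (w : 'rV[nat]_q) : C != set0 ->
  dominated [fset a i | i in C] w <->
  forall A : {set 'I_q}, (wt w A <= maxC C (fun i => wt (a i) A))%N.
Proof.
move=> C0; split=> [dom A | le A].
  have [_ /imfsetP[i iC ->] leA] := dom A.
  by apply: leq_trans leA _; apply: (leq_bigmax_cond (F := fun i => wt (a i) A)).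
have C_gt0 : (0 < #|C|)%N by rewrite card_gt0.
have [i iC eqA] := eq_bigmax_cond (fun i => wt (a i) A) C_gt0.
by exists (a i); [apply: in_imfset | rewrite -eqA; apply: le].
Qed.

Lemma geq_minC C (f : 'I_d -> nat) i : i \in C -> (minC C f <= f i)%N.
Proof.
rewrite /minC => iC; have : i \in index_enum 'I_d by rewrite mem_index_enum.
elim: (index_enum _) => // j l IH; rewrite inE big_cons.
case: eqP => [<- _ | _ /= /IH le]; first by rewrite iC geq_minl.
by case: ifP => // _; apply: leq_trans le; apply: geq_minr.
Qed.

Hypothesis aN : forall i, inN r (a i).

(** The lower bounds in (3) follow from the upper bounds on complements. *)
Lemma maxC_minC C (w : 'rV[nat]_q) : C != set0 -> inN r w ->
  (forall A : {set 'I_q}, (wt w A <= maxC C (fun i => wt (a i) A))%N) <->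
  (forall A : {set 'I_q}, (minC C (fun i => wt (a i) A) <= wt w A
                             <= maxC C (fun i => wt (a i) A))%N).
Proof.
move=> C0 wN; split=> [le A | le A]; last by case/andP: (le A).
rewrite le andbT; have /(dominated_maxC _ C0) dom := le.
have CN : {in [fset a i | i in C], forall x, inN r x} by move=> _ /imfsetP[i _ ->].
have [_ /imfsetP[i iC ->] leA] := dominated_lower A CN wN dom.
by apply: leq_trans leA; apply: (geq_minC (fun i => wt (a i) A)).
Qed.

(** For the direction from the inequalities to the Scarf property, the set C of
    indices with a_i <> w describes the face s `\ w of the criterion, even when
    the family a has repetitions. *)
Lemma scarf_maxC (k : fieldType) s : s = [fset a i | i in 'I_d] -> taylor r s ->
  scarf k r s <->
  forall C, C != set0 -> forall w : 'rV[nat]_q, inN r w ->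
    (forall A : {set 'I_q}, (wt w A <= maxC C (fun i => wt (a i) A))%N)
    <-> w \in [fset a i | i in C].
Proof.
move=> es ts; split=> [/scarfP[_ sc] C C0 w wN | hull].
  split=> [/(dominated_maxC _ C0) dom | wC].
    apply/negPn/negP => nwC; apply: (sc w) => //; apply: dominatedS dom.
    apply/fsubsetP => _ /imfsetP[i iC ->]; rewrite !inE es in_imfset // andbT.
    by apply: contraNneq nwC => <-; apply: in_imfset.
  by apply/(dominated_maxC _ C0); apply: dominated_self.
apply/scarfP; split=> // w wN dom.
pose C := [set i | a i != w].
have sC : s `\ w `<=` [fset a i | i in C].
  apply/fsubsetP => x; rewrite es => /fsetD1P[nxw /imfsetP[i _ ex]].
  by rewrite ex in nxw *; apply: in_imfset; rewrite inE.
have domC := dominatedS sC dom.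
have C0 : C != set0.
  by have [_ /imfsetP[i iC _] _] := domC set0; apply/set0Pn; exists i.
have /(hull C C0 w wN) /imfsetP[i] := proj1 (dominated_maxC w C0) domC.
by rewrite inE => nw ew; rewrite ew eqxx in nw.
Qed.

End Family.

Local Open Scope fset_scope.

Theorem theorem4p2 (k : fieldType) (q r d : nat) (a : 'I_d -> 'rV[nat]_q)
    (s : {fset 'rV[nat]_q}) :
  (0 < q)%N -> (0 < r)%N ->
  s = [fset a i | i in 'I_d] -> taylor r s ->
  [<-> (* (1) *)
       scarf k r s;
       (* (2) *)
       forall C : {set 'I_d}, C != set0 ->
       forall w : 'rV[nat]_q, inN r w ->
         (forall A : {set 'I_q},
            (dotv w (charv A) <= maxC C (fun i => dotv (a i) (charv A)))%N)
         <-> w \in [fset a i | i in C];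
       (* (3) *)
       forall C : {set 'I_d}, C != set0 ->
       forall w : 'rV[nat]_q, inN r w ->
         (forall A : {set 'I_q},
            (minC C (fun i => dotv (a i) (charv A)) <= dotv w (charv A)
               <= maxC C (fun i => dotv (a i) (charv A)))%N)
         <-> w \in [fset a i | i in C];
       (* (4) *)
       forall p : nat, scarf k r [fset append0 p x | x in s];
       (* (5) *)
       forall p : nat, scarf k r [fset prepend0 p x | x in s];
       (* (6) *)
       forall pi : {perm 'I_q}, scarf k r [fset permv pi x | x in s];
       (* (7): the hypothesis on v makes r + |v| nonnegative *)
       forall v : 'rV[int]_q, (forall i : 'I_d, nonnegv (toZ (a i) + v)) ->
         scarf k `|(r%:Z + norm1 v)%R|%N [fset toN (toZ x + v) | x in s]].
Proof.
move=> _ _ es ts.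
have aN i : inN r (a i) by apply: (proj2 ts); rewrite es in_imfset.
have [sc2 scof2] := scarf_maxC k es ts.
have push p (h : 'I_q -> 'I_p) (f : 'rV[nat]_q -> 'rV[nat]_p) :
    injective h -> f =1 pushv h -> scarf k r [fset f x | x in s] <-> scarf k r s.
  move=> h_inj fE; rewrite -(scarf_pushv h_inj).
  by rewrite (_ : [fset f x | x in s] = [fset pushv h x | x in s]) //; apply: eq_imfset.
have append p : scarf k r [fset append0 p x | x in s] <-> scarf k r s.
  by apply: push (@append0E p q); apply: lshift_inj.
have prepend p : scarf k r [fset prepend0 p x | x in s] <-> scarf k r s.
  by apply: push (@prepend0E p q); apply: rshift_inj.
have permute pi : scarf k r [fset permv pi x | x in s] <-> scarf k r s.
  by apply: push (permvE pi); apply: perm_inj.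
tfae.
- exact: sc2.
- by move=> hull C C0 w wN; rewrite -(maxC_minC aN C0 wN); apply: hull.
- move=> hull p; apply/append/scof2 => C C0 w wN.
  by rewrite (maxC_minC aN C0 wN); apply: hull.
- by move=> sc p; apply/prepend; apply/(append 0%N)/sc.
- by move=> sc pi; apply/permute; apply/(prepend 0%N)/sc.
- move=> sc v av; apply: scarf_shiftv; last exact/(permute 1%g)/sc.
  by move=> x; rewrite es => /imfsetP[i _ ->]; apply: av.
have toZ0 x : toN (toZ x + 0)%R = x :> 'rV[nat]_q.
  by apply/rowP => i; rewrite !mxE addr0.
move=> sc; have {sc} := sc 0%R.
have -> : norm1 (0 : 'rV[int]_q)%R = 0%R by apply: big1 => i _; rewrite mxE.
rewrite addr0 absz_nat (_ : [fset toN _ | x in s] = s).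
  by apply=> i j; rewrite addr0 mxE.
apply/fsetP => x; apply/imfsetP/idP => [[y ys ->] | xs]; first by rewrite toZ0.
by exists x; rewrite ?toZ0.
Qed.
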